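(* Let $\nu,\mu>0$, let $(\rho,\tau)$ be a $G$-equivariant pair with $\tau$ smooth, let $\Gamma$ be a discrete subgroup of $G=\mathrm{U}(1)\ltimes\mathbb{C}$ with $\rho(\Gamma)\subset\Gamma$, and let $\chi:\Gamma\to\mathrm{U}(1)$ be a map. Let $B$ be the associated real constant and $\varphi:\mathbb{C}\to\mathbb{R}$ an associated smooth phase function, as defined in the context. Let $\mathcal{W}$ be the transformation $[\mathcal{W}f](z)=e^{i\varphi(z)}f(z)$. Then the image under $\mathcal{W}$ of the space of mixed automorphic functions $$\mathcal{M}^{\nu,\mu}_{\rho,\tau}(\mathbb{C})=\{F\in\mathcal{C}^\infty(\mathbb{C}):\ F(\gamma\cdot z)=\chi(\gamma)\,j^\nu(\gamma,z)\,j^\mu(\rho(\gamma),\tau(z))\,F(z)\ \ \forall\gamma\in\Gamma,\ z\in\mathbb{C}\}$$ is exactly the space of classical $(\Gamma,\chi_\tau)$-automorphic functions $$\mathcal{F}^{B}_{\Gamma,\chi_\tau}(\mathbb{C})=\{F\in\mathcal{C}^\infty(\mathbb{C}):\ F(\gamma\cdot z)=\chi_\tau(\gamma)\,j^{B}(\gamma,z)\,F(z)\ \ \forall\gamma\in\Gamma,\ z\in\mathbb{C}\}$$ associated to the specific map (pseudo-character) $\chi_\tau$ defined on $\Gamma$ by $$\chi_\tau(\gamma)=\chi(\gamma)\exp\Big(i\varphi(\gamma\cdot0)-2i\mu\,\operatorname{Im}\langle\tau(0),\rho(\gamma)^{-1}\cdot0\rangle\Big).$$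
   Context: $G=\mathrm{U}(1)\ltimes\mathbb{C}$ is the group of matrices $[a,b]:=\begin{pmatrix}a&b\\0&1\end{pmatrix}$ with $|a|=1$, $b\in\mathbb{C}$, acting on $\mathbb{C}$ by $[a,b]\cdot z=az+b$. A pair $(\rho,\tau)$ is a $G$-equivariant pair if $\rho:G\to G$ is a group endomorphism and $\tau:\mathbb{C}\to\mathbb{C}$ is a map with $\tau(g\cdot z)=\rho(g)\cdot\tau(z)$ for all $g\in G$, $z\in\mathbb{C}$. Write $\langle z,w\rangle=z\overline{w}$. For $\alpha\in\mathbb{R}$, $g\in G$, $z\in\mathbb{C}$ put $j^\alpha(g,z)=e^{-i\alpha\operatorname{Im}\langle z,g^{-1}\cdot0\rangle}$. The function $B=\nu+\mu\left(\left|\frac{\partial\tau}{\partial z}\right|^2-\left|\frac{\partial\tau}{\partial\bar z}\right|^2\right)$ is a real constant on $\mathbb{C}$. Define the 1-forms $\theta^{\nu,\mu}_\tau=-\frac{\nu}{2}(\bar z\,dz-z\,d\bar z)-\frac{\mu}{2}(\bar\tau\,d\tau-\tau\,d\bar\tau)$ and $\theta_B=-\frac{B}{2}(\bar z\,dz-z\,d\bar z)$. The phase function $\varphi$ is a smooth real-valued function on $\mathbb{C}$ with $\theta^{\nu,\mu}_\tau=\theta_B+i\,d\varphi$; such a function exists and can be chosen freely up to an additive constant.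
   Formalization: The formula for χ_τ is corrected: the exponent is iφ(γ·0) − iφ(0) − iμ Im⟨τ(0),ρ(γ)^{-1}·0⟩, with coefficient μ instead of 2μ and the extra term −iφ(0), since the printed formula fails for the given j^α and θ and for φ(0) not in 2πℤ. *)

(* Defs.v *)
From Stdlib Require Import Reals Lia Eqdep_dec.
From Coquelicot Require Import Coquelicot.

Local Open Scope C_scope.

Definition Cexp (z : C) : C := RtoC (exp (Re z)) * (cos (Im z), sin (Im z)).

Definition herm (z w : C) : C := z * Cconj w.

(** * The group U(1) ⋉ ℂ *)

(** [mkG a b _] is the matrix with rows (a, b) and (0, 1); see [Gmat_mul]. *)
Record G : Type := mkG {
  rot : C;
  trans : C;
  rot_unit : Cmod rot = 1%R }.

Lemma G_eq (g h : G) : rot g = rot h -> trans g = trans h -> g = h.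
Proof.
destruct g as [a b u], h as [a' b' u']; simpl; intros Ha Hb; subst.
f_equal; apply UIP_dec, Req_dec_T.
Qed.

Lemma Gone_unit : Cmod (RtoC 1) = 1%R.
Proof. exact Cmod_1. Qed.

Lemma Gmul_unit (g h : G) : Cmod (rot g * rot h) = 1%R.
Proof. rewrite Cmod_mult, !rot_unit; ring. Qed.

Lemma Ginv_unit (g : G) : Cmod (Cconj (rot g)) = 1%R.
Proof. rewrite Cmod_conj; apply rot_unit. Qed.

Definition Gone : G := mkG 1 0 Gone_unit.

Definition Gmul (g h : G) : G :=
  mkG (rot g * rot h) (rot g * trans h + trans g) (Gmul_unit g h).

Definition Ginv (g : G) : G :=
  mkG (Cconj (rot g)) (- (Cconj (rot g) * trans g)) (Ginv_unit g).

Definition act (g : G) (z : C) : C := rot g * z + trans g.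

Definition Gmat (g : G) : @matrix C 2 2 :=
  [[rot g, trans g], [RtoC 0, RtoC 1]].

Lemma Gmat_mul (g h : G) : Gmat (Gmul g h) = Mmult (Gmat g) (Gmat h).
Proof.
apply (coeff_mat_ext_aux zero zero); intros i j Hi Hj.
unfold Mmult; rewrite coeff_mat_bij by assumption.
destruct i as [|[|i]], j as [|[|j]];
  try (exfalso; lia);
  simpl pred; rewrite sum_Sn, sum_O; unfold Gmat, coeff_mat; simpl;
  unfold plus, mult; simpl; ring.
Qed.

Lemma Cconj_mul_unit (a : C) : Cmod a = 1%R -> Cconj a * a = 1.
Proof.
intros Ha; rewrite Cmult_comm, <- Cmod2_conj, Ha.
f_equal; ring.
Qed.

Lemma Gmul_inv_l (g : G) : Gmul (Ginv g) g = Gone.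
Proof.
apply G_eq; simpl; [apply Cconj_mul_unit, rot_unit | ring].
Qed.

Lemma act_mul (g h : G) (z : C) : act (Gmul g h) z = act g (act h z).
Proof. unfold act; simpl; ring. Qed.

Definition is_endomorphism (rho : G -> G) : Prop :=
  forall g h : G, rho (Gmul g h) = Gmul (rho g) (rho h).

Definition equivariant_pair (rho : G -> G) (tau : C -> C) : Prop :=
  is_endomorphism rho /\
  forall (g : G) (z : C), tau (act g z) = act (rho g) (tau z).

Definition is_subgroup (Gam : G -> Prop) : Prop :=
  Gam Gone /\
  (forall g h : G, Gam g -> Gam h -> Gam (Gmul g h)) /\
  (forall g : G, Gam g -> Gam (Ginv g)).

(** The subspace topology induced from G ⊂ ℂ × ℂ is the discrete one. *)
Definition is_discrete (Gam : G -> Prop) : Prop :=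
  forall g : G, Gam g ->
  exists eps : R, (0 < eps)%R /\
    forall h : G, Gam h ->
      (Cmod (rot h - rot g) < eps)%R -> (Cmod (trans h - trans g) < eps)%R ->
      h = g.

(** * Smooth functions on ℂ ≅ ℝ² *)

(** Real smoothness: all iterated partial derivatives in (Re z, Im z) exist
    and are continuous; this is not complex differentiability. *)
Definition smoothR (f : C -> R) : Prop :=
  forall (n : nat) (x y : R), ex_diff_n (fun u v => f (u, v)) n x y.

Definition smoothC (f : C -> C) : Prop :=
  smoothR (fun z => Re (f z)) /\ smoothR (fun z => Im (f z)).

Definition partial_x (f : C -> C) (z : C) : C :=
  (Derive (fun t => Re (f (t, Im z))) (Re z),
   Derive (fun t => Im (f (t, Im z))) (Re z)).

Definition partial_y (f : C -> C) (z : C) : C :=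
  (Derive (fun t => Re (f (Re z, t))) (Im z),
   Derive (fun t => Im (f (Re z, t))) (Im z)).

Definition partial_z (f : C -> C) (z : C) : C :=
  (partial_x f z - Ci * partial_y f z) / 2.

Definition partial_zbar (f : C -> C) (z : C) : C :=
  (partial_x f z + Ci * partial_y f z) / 2.

(** A complex 1-form on ℂ: [w z v] is its value at the point [z] on the
    tangent vector [v], identified with a complex number. *)
Definition form : Type := C -> C -> C.

Definition diff (f : C -> C) : form :=
  fun z v => RtoC (Re v) * partial_x f z + RtoC (Im v) * partial_y f z.

(** The 1-form - (al / 2) (conj f df - f d(conj f)). *)
Definition theta (al : R) (f : C -> C) : form :=
  fun z v =>
    - (RtoC al / 2) *
      (Cconj (f z) * diff f z v - f z * diff (fun w => Cconj (f w)) z v).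

Definition theta_B (B : R) : form := theta B (fun z => z).

Definition theta_tau (nu mu : R) (tau : C -> C) : form :=
  fun z v => theta nu (fun w => w) z v + theta mu tau z v.

Definition B_function (nu mu : R) (tau : C -> C) (z : C) : R :=
  (nu + mu * (Cmod (partial_z tau z) ^ 2 - Cmod (partial_zbar tau z) ^ 2))%R.

Definition is_phase (nu mu : R) (tau : C -> C) (B : R) (phi : C -> R) : Prop :=
  smoothR phi /\
  forall z v : C,
    theta_tau nu mu tau z v =
    theta_B B z v + Ci * diff (fun w => RtoC (phi w)) z v.

(** * Automorphic functions *)

Definition jfactor (al : R) (g : G) (z : C) : C :=
  Cexp (- (Ci * RtoC al * RtoC (Im (herm z (act (Ginv g) 0))))).

Definition mixed_automorphic (Gam : G -> Prop) (chi : G -> C) (nu mu : R)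
    (rho : G -> G) (tau : C -> C) (F : C -> C) : Prop :=
  smoothC F /\
  forall (g : G) (z : C), Gam g ->
    F (act g z) = chi g * jfactor nu g z * jfactor mu (rho g) (tau z) * F z.

Definition automorphic (Gam : G -> Prop) (chi : G -> C) (B : R)
    (F : C -> C) : Prop :=
  smoothC F /\
  forall (g : G) (z : C), Gam g ->
    F (act g z) = chi g * jfactor B g z * F z.

Definition W_transform (phi : C -> R) (f : C -> C) : C -> C :=
  fun z => Cexp (Ci * RtoC (phi z)) * f z.

(** With the normalisation phi 0 = 0 the second term disappears.  The
    coefficient of mu is 1, as required by [jfactor] and [theta]: at z = 0 the
    automorphy factor [jfactor mu (rho g) (tau 0)] contributes it once. *)
Definition chi_tau (chi : G -> C) (mu : R) (rho : G -> G) (tau : C -> C)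
    (phi : C -> R) : G -> C :=
  fun g =>
    chi g *
    Cexp (Ci * RtoC (phi (act g 0)) - Ci * RtoC (phi (RtoC 0))
          - Ci * RtoC mu * RtoC (Im (herm (tau (RtoC 0)) (act (Ginv (rho g)) 0)))).

(* Main.v *)
Require Import Defs.
From Stdlib Require Import Reals.
From Coquelicot Require Import Coquelicot.
From Stdlib Require Import Lra Lia FunctionalExtensionality.

(** The 1-forms are [theta al f = - i al Im (conj f df)], so the phase satisfies
    [dphi = (B - nu) Im (conj z dz) - mu Im (conj tau dtau)].  Pulling this back
    by [g] and using [tau o g = rho(g) o tau], the quadratic terms are unchanged
    because rotations are unitary; what remains is exact, and
    [phi (g z) - phi z] equals the difference of the exponents of the two
    automorphy factors up to a constant, found by putting [z = 0].  Hence
    multiplication by [exp (i phi)] intertwines the two functional equations, and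
    multiplication by [exp (- i phi)] inverts it. *)

Local Open Scope R_scope.

(** * Closure of $C^n$ functions of two real variables under algebra, cosine and sine *)

Definition of_class (n : nat) (f : R -> R -> R) : Prop :=
  forall x y : R, ex_diff_n f n x y.

Lemma of_class_continuous (n : nat) (f : R -> R -> R) :
  of_class n f -> forall x y, continuity_2d_pt f x y.
Proof. intros Hf x y; specialize (Hf x y); destruct n; apply Hf. Qed.

Lemma of_class_pred (n : nat) (f : R -> R -> R) :
  of_class (S n) f -> of_class n f.
Proof. intros Hf x y; apply (ex_diff_n_m (S n)); [lia | apply Hf]. Qed.

Lemma of_class_is_derive_x (n : nat) (f : R -> R -> R) (x y : R) :
  of_class (S n) f ->
  is_derive (fun u => f u y) x (Derive (fun u => f u y) x).
Proof. intros Hf; apply Derive_correct, (Hf x y). Qed.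

Lemma of_class_is_derive_y (n : nat) (f : R -> R -> R) (x y : R) :
  of_class (S n) f ->
  is_derive (fun v => f x v) y (Derive (fun v => f x v) y).
Proof. intros Hf; apply Derive_correct, (Hf x y). Qed.

Lemma of_class_Derive_x (n : nat) (f : R -> R -> R) :
  of_class (S n) f -> of_class n (fun x y => Derive (fun u => f u y) x).
Proof. intros Hf x y; apply (Hf x y). Qed.

Lemma of_class_Derive_y (n : nat) (f : R -> R -> R) :
  of_class (S n) f -> of_class n (fun x y => Derive (fun v => f x v) y).
Proof. intros Hf x y; apply (Hf x y). Qed.

(** The induction step used throughout: [ex_diff_n] speaks of [Derive], while [fx] and [fy] can be
    explicit formulas to which the induction hypothesis applies. Regularity passes between the two
    because they agree everywhere. *)
Lemma of_class_succ (n : nat) (f fx fy : R -> R -> R) :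
  (forall x y, continuity_2d_pt f x y) ->
  (forall x y, is_derive (fun u => f u y) x (fx x y)) ->
  (forall x y, is_derive (fun v => f x v) y (fy x y)) ->
  of_class n fx -> of_class n fy -> of_class (S n) f.
Proof.
intros Hc Hx Hy Hfx Hfy x y; simpl; repeat split.
- apply Hc.
- eexists; apply Hx.
- eexists; apply Hy.
- apply (ex_diff_n_ext_loc fx); [|apply Hfx].
  apply locally_2d_forall; intros u v; symmetry.
  apply is_derive_unique, Hx.
- apply (ex_diff_n_ext_loc fy); [|apply Hfy].
  apply locally_2d_forall; intros u v; symmetry.
  apply is_derive_unique, Hy.
Qed.

Lemma of_class_plus (n : nat) (f g : R -> R -> R) :
  of_class n f -> of_class n g -> of_class n (fun x y => f x y + g x y).
Proof.
revert f g; induction n as [|n IH]; intros f g Hf Hg.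
- intros x y; split; [|exact I].
  apply continuity_2d_pt_plus; [apply Hf | apply Hg].
- apply of_class_succ with
    (fx := fun x y => Derive (fun u => f u y) x + Derive (fun u => g u y) x)
    (fy := fun x y => Derive (fun v => f x v) y + Derive (fun v => g x v) y).
  + intros x y; apply continuity_2d_pt_plus; [apply Hf | apply Hg].
  + intros x y.
    apply (is_derive_plus (fun u => f u y) (fun u => g u y));
      now apply of_class_is_derive_x with n.
  + intros x y.
    apply (is_derive_plus (fun v => f x v) (fun v => g x v));
      now apply of_class_is_derive_y with n.
  + apply IH; now apply of_class_Derive_x.
  + apply IH; now apply of_class_Derive_y.
Qed.

Lemma of_class_mult (n : nat) (f g : R -> R -> R) :
  of_class n f -> of_class n g -> of_class n (fun x y => f x y * g x y).
Proof.
revert f g; induction n as [|n IH]; intros f g Hf Hg.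
- intros x y; split; [|exact I].
  apply continuity_2d_pt_mult; [apply Hf | apply Hg].
- apply of_class_succ with
    (fx := fun x y => Derive (fun u => f u y) x * g x y
                      + f x y * Derive (fun u => g u y) x)
    (fy := fun x y => Derive (fun v => f x v) y * g x y
                      + f x y * Derive (fun v => g x v) y).
  + intros x y; apply continuity_2d_pt_mult; [apply Hf | apply Hg].
  + intros x y.
    apply (is_derive_mult (fun u => f u y) (fun u => g u y));
      [now apply of_class_is_derive_x with n | now apply of_class_is_derive_x with n |].
    intros; apply Rmult_comm.
  + intros x y.
    apply (is_derive_mult (fun v => f x v) (fun v => g x v));
      [now apply of_class_is_derive_y with n | now apply of_class_is_derive_y with n |].
    intros; apply Rmult_comm.
  + apply of_class_plus; apply IH;
      auto using of_class_Derive_x, of_class_pred.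
  + apply of_class_plus; apply IH;
      auto using of_class_Derive_y, of_class_pred.
Qed.

Lemma of_class_const (n : nat) (c : R) : of_class n (fun _ _ => c).
Proof.
revert c; induction n as [|n IH]; intros c.
- intros x y; split; [apply continuity_2d_pt_const | exact I].
- apply of_class_succ with (fx := fun _ _ => 0) (fy := fun _ _ => 0); try apply IH.
  + intros; apply continuity_2d_pt_const.
  + intros; apply @is_derive_const.
  + intros; apply @is_derive_const.
Qed.

Lemma of_class_opp (n : nat) (f : R -> R -> R) :
  of_class n f -> of_class n (fun x y => - f x y).
Proof.
intros Hf.
replace (fun x y => - f x y) with (fun x y => -1 * f x y)
  by (extensionality x; extensionality y; ring).
apply of_class_mult; [apply of_class_const | exact Hf].
Qed.

(** The two claims go through one induction, since the partials of each function involve the other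
    one at the previous order. *)
Lemma of_class_cos_sin (n : nat) (f : R -> R -> R) :
  of_class n f ->
  of_class n (fun x y => cos (f x y)) /\ of_class n (fun x y => sin (f x y)).
Proof.
revert f; induction n as [|n IH]; intros f Hf.
- split; intros x y; (split; [|exact I]);
    (apply continuity_1d_2d_pt_comp; [|apply Hf]).
  + apply continuity_cos.
  + apply continuity_sin.
- destruct (IH f (of_class_pred _ _ Hf)) as [IHc IHs].
  assert (Hx := of_class_Derive_x _ _ Hf); assert (Hy := of_class_Derive_y _ _ Hf).
  split.
  + apply of_class_succ with
      (fx := fun x y => Derive (fun u => f u y) x * - sin (f x y))
      (fy := fun x y => Derive (fun v => f x v) y * - sin (f x y));
      try (apply of_class_mult; [assumption | now apply of_class_opp]);
      intros x y.
    * apply continuity_1d_2d_pt_comp; [apply continuity_cos | apply Hf].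
    * apply (is_derive_comp cos (fun u => f u y)); [apply is_derive_cos|].
      now apply of_class_is_derive_x with n.
    * apply (is_derive_comp cos (fun v => f x v)); [apply is_derive_cos|].
      now apply of_class_is_derive_y with n.
  + apply of_class_succ with
      (fx := fun x y => Derive (fun u => f u y) x * cos (f x y))
      (fy := fun x y => Derive (fun v => f x v) y * cos (f x y));
      try (apply of_class_mult; assumption);
      intros x y.
    * apply continuity_1d_2d_pt_comp; [apply continuity_sin | apply Hf].
    * apply (is_derive_comp sin (fun u => f u y)); [apply is_derive_sin|].
      now apply of_class_is_derive_x with n.
    * apply (is_derive_comp sin (fun v => f x v)); [apply is_derive_sin|].
      now apply of_class_is_derive_y with n.
Qed.

Lemma smoothR_opp (f : C -> R) : smoothR f -> smoothR (fun z => - f z).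
Proof. intros Hf n; apply of_class_opp; intros x y; apply Hf. Qed.

(** * Exponentials of imaginary numbers and the transform [W_transform] *)

Lemma Cexp_imaginary (x : R) : Cexp (Ci * RtoC x) = (cos x, sin x).
Proof.
unfold Cexp; simpl.
replace (0 * x - 1 * 0) with 0 by ring; replace (0 * 0 + 1 * x) with x by ring.
rewrite exp_0; apply Cmult_1_l.
Qed.

Lemma Cexp_imaginary_plus (x y : R) :
  Cexp (Ci * RtoC (x + y)) = (Cexp (Ci * RtoC x) * Cexp (Ci * RtoC y))%C.
Proof.
rewrite !Cexp_imaginary, cos_plus, sin_plus; unfold Cmult; simpl; f_equal; ring.
Qed.

Lemma Cexp_imaginary_opp (x : R) :
  (Cexp (Ci * RtoC (- x)) * Cexp (Ci * RtoC x))%C = 1.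
Proof.
rewrite <- Cexp_imaginary_plus, Rplus_opp_l, Cexp_imaginary, cos_0, sin_0.
reflexivity.
Qed.

Lemma W_transform_smooth (phi : C -> R) (f : C -> C) :
  smoothR phi -> smoothC f -> smoothC (W_transform phi f).
Proof.
intros Hphi [Hre Him].
assert (Hcs : forall n,
  of_class n (fun u v => cos (phi (u, v))) /\ of_class n (fun u v => sin (phi (u, v))))
  by (intros n; apply (of_class_cos_sin n (fun u v => phi (u, v))); intros x y; apply Hphi).
unfold W_transform; split; intros n.
- replace (fun u v => Re (Cexp (Ci * RtoC (phi (u, v))) * f (u, v))) with
    (fun u v => cos (phi (u, v)) * Re (f (u, v)) + - (sin (phi (u, v)) * Im (f (u, v))))
    by (extensionality u; extensionality v; rewrite Cexp_imaginary; reflexivity).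
  apply of_class_plus; [|apply of_class_opp]; apply of_class_mult;
    solve [apply Hcs | intros x y; apply Hre | intros x y; apply Him].
- replace (fun u v => Im (Cexp (Ci * RtoC (phi (u, v))) * f (u, v))) with
    (fun u v => cos (phi (u, v)) * Im (f (u, v)) + sin (phi (u, v)) * Re (f (u, v)))
    by (extensionality u; extensionality v; rewrite Cexp_imaginary; reflexivity).
  apply of_class_plus; apply of_class_mult;
    solve [apply Hcs | intros x y; apply Hre | intros x y; apply Him].
Qed.

(** Used for surjectivity: the preimage of $f$ is $e^{-i\varphi}f$. *)
Lemma W_transform_opp (phi : C -> R) (f : C -> C) :
  W_transform phi (W_transform (fun z => - phi z) f) = f.
Proof.
extensionality z; unfold W_transform.
rewrite Cmult_assoc, (Cmult_comm (Cexp _)), Cexp_imaginary_opp; apply Cmult_1_l.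
Qed.

(** * Directional derivatives and the differential of the phase *)

Definition ddir (f : C -> R) (z v : C) : R :=
  Re v * Derive (fun t => f (t, Im z)) (Re z)
  + Im v * Derive (fun t => f (Re z, t)) (Im z).

(** The chain rule along a real line, which reduces identities between 1-forms to one-variable
    calculus. *)
Lemma is_derive_line (f : C -> R) (p v : C) (t : R) :
  smoothR f ->
  is_derive (fun s => f (p + RtoC s * v)%C) t (ddir f (p + RtoC t * v)%C v).
Proof.
intros Hf.
assert (Hf1 : of_class 1 (fun x y => f (x, y))) by (intros x y; apply Hf).
set (X := fun s => Re p + s * Re v); set (Y := fun s => Im p + s * Im v).
assert (HXY : forall s, (p + RtoC s * v)%C = (X s, Y s)).
{ intros s; unfold X, Y; destruct p, v; unfold Cplus, Cmult; simpl; f_equal; ring. }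
apply is_derive_ext with (fun s => f (X s, Y s)); [intros s; now rewrite HXY|].
rewrite HXY; unfold ddir; simpl.
rewrite (Rmult_comm (Re v)), (Rmult_comm (Im v)).
apply is_derive_Reals, (derivable_pt_lim_comp_2d (fun x y => f (x, y)) X Y).
(* Joint differentiability follows from a continuous $x$-partial near the point and the existence of
   the $y$-partial at it. *)
- apply filterdiff_differentiable_pt_lim.
  apply (is_derive_filterdiff (fun x y => f (x, y)) (X t) (Y t)
           (fun x y => Derive (fun u => f (u, y)) x)).
  + apply filter_forall; intros [x y].
    apply (of_class_is_derive_x 0 (fun x y => f (x, y))), Hf1.
  + apply (of_class_is_derive_y 0 (fun x y => f (x, y))), Hf1.
  + apply (continuity_2d_pt_filterlim (fun x y => Derive (fun u => f (u, y)) x)).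
    apply (of_class_continuous 0 _ (of_class_Derive_x 0 (fun x y => f (x, y)) Hf1)).
- apply is_derive_Reals; unfold X; auto_derive; [exact I | ring].
- apply is_derive_Reals; unfold Y; auto_derive; [exact I | ring].
Qed.

Lemma diff_ddir (f : C -> C) (z v : C) :
  diff f z v = (ddir (fun w => Re (f w)) z v, ddir (fun w => Im (f w)) z v).
Proof.
unfold diff, ddir, partial_x, partial_y, Cplus, Cmult; simpl; f_equal; ring.
Qed.

Lemma diff_id (z v : C) : diff (fun w => w) z v = v.
Proof.
rewrite diff_ddir; unfold ddir; simpl.
rewrite !Derive_id, !Derive_const; destruct v; simpl; f_equal; ring.
Qed.

Lemma diff_conj (f : C -> C) (z v : C) :
  diff (fun w => Cconj (f w)) z v = Cconj (diff f z v).
Proof.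
rewrite !diff_ddir; unfold ddir; simpl; rewrite !Derive_opp.
unfold Cconj; unfold Re, Im; simpl; f_equal; ring.
Qed.

(** Since $d\bar f=\overline{df}$, the bracket in [theta] is $w-\bar w=2i\operatorname{Im}w$ with
    $w=\bar f\,df$. *)
Lemma theta_eq (al : R) (f : C -> C) (z v : C) :
  theta al f z v = (- (Ci * RtoC (al * Im (Cconj (f z) * diff f z v))))%C.
Proof.
unfold theta; rewrite diff_conj.
destruct (f z) as [a b], (diff f z v) as [c d].
apply injective_projections; simpl; field.
Qed.

Lemma ddir_phase (nu mu B : R) (tau : C -> C) (phi : C -> R) (z v : C) :
  is_phase nu mu tau B phi ->
  ddir phi z v =
  (B - nu) * Im (Cconj z * v) - mu * Im (Cconj (tau z) * diff tau z v).
Proof.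
intros [_ H]; specialize (H z v).
unfold theta_tau, theta_B in H; rewrite !theta_eq, !diff_id, (diff_ddir (fun w => RtoC (phi w))) in H.
(* All terms are $i$ times a real number, so the imaginary part loses nothing and gives
   $d\varphi$. *)
apply (f_equal Im) in H.
change (ddir (fun w => Re (RtoC (phi w))) z v) with (ddir phi z v) in H.
set (p := Im (Cconj z * v)) in *; set (q := Im (Cconj (tau z) * diff tau z v)) in *.
simpl in H; lra.
Qed.

(** * Equivariance of differentials and the cocycle identity of the phase *)

Lemma act_line (g : G) (z : C) (t : R) :
  act g (RtoC t * z) = (trans g + RtoC t * (rot g * z))%C.
Proof. unfold act; ring. Qed.

Lemma Ginv_act_0 (g : G) : act (Ginv g) 0 = (- (Cconj (rot g) * trans g))%C.
Proof. unfold act; simpl; ring. Qed.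

(** Differentiate $\tau(g\cdot(z+sv))=h\cdot\tau(z+sv)$ at $s=0$: the affine maps $g$ and $h$
    contribute only their rotations. *)
Lemma diff_equivariant (tau : C -> C) (g h : G) (z v : C) :
  smoothC tau -> (forall w, tau (act g w) = act h (tau w)) ->
  diff tau (act g z) (rot g * v)%C = (rot h * diff tau z v)%C.
Proof.
intros [Hre Him] Heq.
(* Both base points are written as points of parameter $0$ on a line, the form in which
   [is_derive_line] applies. *)
assert (Hg : (act g z = act g z + RtoC 0 * (rot g * v))%C) by ring.
assert (Hz : (z = z + RtoC 0 * v)%C) by ring.
assert (Hline : forall s : R,
  tau (act g z + RtoC s * (rot g * v))%C = act h (tau (z + RtoC s * v)%C)).
{ intros s; rewrite <- Heq; f_equal; unfold act; ring. }
assert (Dre := is_derive_line _ z v 0 Hre); assert (Dim := is_derive_line _ z v 0 Him).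
assert (Ere := is_derive_line _ (act g z) (rot g * v)%C 0 Hre).
assert (Eim := is_derive_line _ (act g z) (rot g * v)%C 0 Him).
rewrite <- Hz in Dre, Dim; rewrite <- Hg in Ere, Eim.
rewrite !diff_ddir.
apply injective_projections; simpl.
- rewrite <- (is_derive_unique _ _ _ Ere); apply is_derive_unique.
  apply is_derive_ext with (fun s =>
    Re (rot h) * Re (tau (z + RtoC s * v)%C)
    - Im (rot h) * Im (tau (z + RtoC s * v)%C) + Re (trans h)).
  { intros s; rewrite Hline; reflexivity. }
  evar_last.
  + apply @is_derive_plus; [|apply @is_derive_const].
    apply @is_derive_minus; apply is_derive_scal; [exact Dre | exact Dim].
  + unfold plus, minus, opp, zero; simpl; unfold plus, Re, Im; simpl; ring.
- rewrite <- (is_derive_unique _ _ _ Eim); apply is_derive_unique.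
  apply is_derive_ext with (fun s =>
    Re (rot h) * Im (tau (z + RtoC s * v)%C)
    + Im (rot h) * Re (tau (z + RtoC s * v)%C) + Im (trans h)).
  { intros s; rewrite Hline; reflexivity. }
  evar_last.
  + apply @is_derive_plus; [|apply @is_derive_const].
    apply @is_derive_plus; apply is_derive_scal; [exact Dim | exact Dre].
  + unfold plus, minus, opp, zero; simpl; unfold plus, Re, Im; simpl; ring.
Qed.

(** The rotation has modulus one, so the quadratic term survives unchanged. The cross term with the
    translation is the pairing with $g^{-1}\cdot0=-\bar a b$ that occurs in [jfactor]. *)
Lemma conj_act_mul (g : G) (p v : C) :
  (Cconj (act g p) * (rot g * v) = Cconj p * v - herm v (act (Ginv g) 0))%C.
Proof.
rewrite Ginv_act_0; unfold act, herm.
rewrite Copp_conj, Cplus_conj, !Cmult_conj, Cconj_conj.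
transitivity (Cconj (rot g) * rot g * (Cconj p * v) + rot g * v * Cconj (trans g))%C;
  [ring | rewrite (Cconj_mul_unit _ (rot_unit g)); ring].
Qed.

Lemma is_derive_Im_herm_line (f : C -> C) (v w : C) (t : R) :
  smoothC f ->
  is_derive (fun s => Im (herm (f (RtoC s * v)%C) w)) t
    (Im (herm (diff f (RtoC t * v)%C v) w)).
Proof.
intros [Hre Him].
assert (Dre := is_derive_line _ 0 v t Hre); assert (Dim := is_derive_line _ 0 v t Him).
rewrite Cplus_0_l in Dre, Dim; rewrite diff_ddir.
apply is_derive_ext with (fun s =>
  - Im w * Re (f (0 + RtoC s * v)%C) + Re w * Im (f (0 + RtoC s * v)%C)).
{ intros s; rewrite Cplus_0_l; unfold herm; simpl; unfold Re, Im; ring. }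
evar_last.
- apply @is_derive_plus; apply is_derive_scal; [exact Dre | exact Dim].
- unfold plus, herm; simpl; unfold Re, Im; simpl; ring.
Qed.

Lemma phase_cocycle (nu mu B : R) (rho : G -> G) (tau : C -> C) (phi : C -> R)
    (g : G) (z : C) :
  equivariant_pair rho tau -> smoothC tau -> is_phase nu mu tau B phi ->
  phi (act g z) - nu * Im (herm z (act (Ginv g) 0))
    - mu * Im (herm (tau z) (act (Ginv (rho g)) 0))
  = phi (act g 0) - phi 0 - mu * Im (herm (tau 0) (act (Ginv (rho g)) 0))
    - B * Im (herm z (act (Ginv g) 0)) + phi z.
Proof.
intros [_ Heq] Htau Hphi.
set (b := act (Ginv g) 0); set (b' := act (Ginv (rho g)) 0).
(* The identity restricted to the segment from $0$ to $z$, at the point $tz$. The pairing of $tz$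
   with [b] is linear in $t$, whence the explicit factor $t$. *)
set (k := fun t : R => phi (trans g + RtoC t * (rot g * z))%C
                       - phi (0 + RtoC t * z)%C + t * ((B - nu) * Im (herm z b))
                       - mu * Im (herm (tau (RtoC t * z)%C) b')).
assert (Hk : k 0 = k 1).
{ apply eq_is_derive; [intros t _ | lra].
  evar_last.
  - unfold k.
    apply @is_derive_minus;
      [apply @is_derive_plus; [apply @is_derive_minus; apply is_derive_line, Hphi |] |].
    + apply @is_derive_scal_l, @is_derive_id.
    + apply is_derive_scal, is_derive_Im_herm_line, Htau.
  (* The formula for $d\varphi$ is used at $g\cdot tz$ and at $tz$. The quadratic terms [P] and [Q]
     cancel between them, and the leftover pairings [H] and [K] cancel against the last two terms of
     [k]. *)
  - rewrite <- act_line, Cplus_0_l, !(ddir_phase _ _ _ _ _ _ _ Hphi), Heq.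
    rewrite (diff_equivariant tau g (rho g)) by auto.
    rewrite !conj_act_mul; fold b b'.
    set (P := (Cconj (RtoC t * z) * z)%C); set (H := herm z b).
    set (Q := (Cconj (tau (RtoC t * z)%C) * diff tau (RtoC t * z)%C z)%C).
    set (K := herm (diff tau (RtoC t * z)%C z) b').
    unfold plus, minus, opp, scal, one, zero; simpl.
    unfold plus, mult; simpl; unfold Im; ring. }
(* At $t=0$ only the constant with $\varphi(g\cdot0)$, $\varphi(0)$ and $\tau(0)$ remains; $t=1$
   gives the values at $z$. *)
unfold k in Hk; rewrite <- !act_line, !Cmult_0_l, !Cmult_1_l, !Cplus_0_l in Hk.
lra.
Qed.

(** * Comparison of the automorphy factors and of the two function spaces *)

Lemma jfactor_eq (al : R) (g : G) (z : C) :
  jfactor al g z = Cexp (Ci * RtoC (- (al * Im (herm z (act (Ginv g) 0))))).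
Proof.
unfold jfactor; f_equal; rewrite RtoC_opp, RtoC_mult; ring.
Qed.

(** The exponential of [phase_cocycle], multiplied by [chi g]: its constant part is exactly the
    exponent that [chi_tau] adds to [chi]. *)
Lemma factor_W_transform (nu mu B : R) (rho : G -> G) (tau : C -> C) (chi : G -> C)
    (phi : C -> R) (g : G) (z : C) :
  equivariant_pair rho tau -> smoothC tau -> is_phase nu mu tau B phi ->
  (Cexp (Ci * RtoC (phi (act g z))) *
    (chi g * jfactor nu g z * jfactor mu (rho g) (tau z)) =
   chi_tau chi mu rho tau phi g * jfactor B g z * Cexp (Ci * RtoC (phi z)))%C.
Proof.
intros Hpair Htau Hphi.
assert (Hc := phase_cocycle nu mu B rho tau phi g z Hpair Htau Hphi).
unfold chi_tau; rewrite !jfactor_eq.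
set (s := Im (herm z _)) in *; set (s' := Im (herm (tau z) _)) in *.
set (s0 := Im (herm (tau 0) _)) in *.
replace (Ci * RtoC (phi (act g 0)) - Ci * RtoC (phi (RtoC 0)) - Ci * RtoC mu * RtoC s0)%C
  with (Ci * RtoC (phi (act g 0) - phi 0 - mu * s0))%C
  by (rewrite !RtoC_minus, RtoC_mult; ring).
(* All factors are merged into one exponential, so that the real identity [Hc] can act on the
   exponent. *)
transitivity (chi g * Cexp (Ci * RtoC (phi (act g z) + - (nu * s) + - (mu * s'))))%C;
  [rewrite !Cexp_imaginary_plus; ring|].
replace (phi (act g z) + - (nu * s) + - (mu * s'))
  with (phi (act g 0) - phi 0 - mu * s0 + - (B * s) + phi z) by lra.
rewrite !Cexp_imaginary_plus; ring.
Qed.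

Theorem theorem5p1 (nu mu : R) (rho : G -> G) (tau : C -> C)
    (Gam : G -> Prop) (chi : G -> C) (B : R) (phi : C -> R)
    (hnu : (0 < nu)%R) (hmu : (0 < mu)%R)
    (hpair : equivariant_pair rho tau) (htau : smoothC tau)
    (hGam : is_subgroup Gam) (hdisc : is_discrete Gam)
    (hrho : forall g : G, Gam g -> Gam (rho g))
    (hchi : forall g : G, Gam g -> Cmod (chi g) = 1%R)
    (hB : forall z : C, B_function nu mu tau z = B)
    (hphi : is_phase nu mu tau B phi) :
  forall F : C -> C,
    (exists f : C -> C,
        mixed_automorphic Gam chi nu mu rho tau f /\ W_transform phi f = F) <->
    automorphic Gam (chi_tau chi mu rho tau phi) B F.
Proof.
intros F.
assert (Hfactor := fun g z => factor_W_transform nu mu B rho tau chi phi g z hpair htau hphi).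
assert (Hsm : smoothR phi) by apply hphi.
split.
- intros [f [[Hf Hmix] <-]]; split; [now apply W_transform_smooth|].
  intros g z Hg; unfold W_transform.
  rewrite (Hmix g z Hg), !Cmult_assoc, <- Hfactor; ring.
- intros [HF Haut]; exists (W_transform (fun z => - phi z) F).
  split; [|apply W_transform_opp].
  split; [now apply W_transform_smooth; [apply smoothR_opp|]|].
  intros g z Hg; unfold W_transform; rewrite (Haut g z Hg).
  (* Inserting $1=e^{i\varphi(z)}e^{-i\varphi(z)}$ produces the right side of [Hfactor]; after
     rewriting, $e^{\pm i\varphi(g\cdot z)}$ cancel and the mixed factor is left. *)
  transitivity (Cexp (Ci * RtoC (- phi (act g z))) *
    (chi_tau chi mu rho tau phi g * jfactor B g z * Cexp (Ci * RtoC (phi z))) *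
    (Cexp (Ci * RtoC (- phi z)) * F z))%C.
  + transitivity (Cexp (Ci * RtoC (- phi (act g z))) *
      (chi_tau chi mu rho tau phi g * jfactor B g z) *
      (Cexp (Ci * RtoC (- phi z)) * Cexp (Ci * RtoC (phi z))) * F z)%C; [|ring].
    rewrite Cexp_imaginary_opp; ring.
  + rewrite <- Hfactor, (Cmult_assoc (Cexp _) (Cexp _)), Cexp_imaginary_opp; ring.
Qed.
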